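(* Let $\ell\ge 0$ be an integer and $n=2\ell+1$. Let $\mathfrak{c}=\mathfrak{so}(n)\ltimes\mathbb{C}^n$ be the Lie algebra of $ISO(n)=SO(n)\ltimes\mathbb{C}^n$, and let $Y(\mathfrak{c})$ be the algebra of polynomial functions on $\mathfrak{c}^*$ invariant under the coadjoint action of $ISO(n)$. Let $\Phi$ be the unique element of $Y(\mathfrak{c})$ whose restriction to the subspace $\mathfrak{h}\subset\mathfrak{c}^*$ is $\varphi_\ell$ (such an element exists and is unique; $\mathfrak{h}$ and $\varphi_\ell$ are defined in the context). Then, up to a sign independent of $(y,w^* )$, $\Phi$ is the Pfaffian $$\Phi(y,w^* )=\pm\operatorname{Pf}\begin{pmatrix} y & -{}^tw^*\\ w^* & 0\end{pmatrix}\qquad\text{for all }(y,w^* )\in\mathfrak{c}^*,$$ the matrix being antisymmetric of size $2\ell+2$.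
   Context: The base field is $\mathbb{C}$. $\mathbb{C}^n$ is identified with column matrices and its dual with row matrices; ${}^tX$ denotes the transpose of $X$. $SO(n)$ is the complex special orthogonal group, and $\mathfrak{so}(n)$ is the Lie algebra of antisymmetric complex $n\times n$ matrices. $\operatorname{Pf}$ is the usual Pfaffian of antisymmetric matrices of even size, so $\operatorname{Pf}(Y)^2=\det Y$. The group $ISO(n)$ is the semidirect product for the natural action, with law $(g,u)(g',u')=(gg',u+gu')$. The Lie algebra $\mathfrak{c}=\mathfrak{so}(n)\times\mathbb{C}^n$ has $[(x,0),(0,u)]=(0,xu)$, with $\mathbb{C}^n$ an abelian ideal. The dual $\mathfrak{c}^*$ is identified with the set of pairs $(y,w^* )$, with $y\in\mathfrak{so}(n)$ and $w^*$ a row vector, through the pairing $\langle(y,w^* ),(x,u)\rangle=\operatorname{tr}(yx)+2w^*u$. (This is the pairing obtained by embedding $\mathfrak{c}$ into $\mathfrak{gl}(n)\ltimes(\mathbb{C}^n\oplus(\mathbb{C}^n)^* )$ via $(x,u)\mapsto(x,u,-{}^tu)$ and identifying $(y,w^* )$ with $(y,w^*,-{}^tw^* )$.) The coadjoint action is $\langle Ad^*(h)\lambda,X\rangle=\langle\lambda,Ad(h^{-1})X\rangle$. For $n=2\ell+1$, $\mathfrak{h}\subset\mathfrak{c}^*$ is the subspace of all pairs $(z,ae_n^* )$, where $a\in\mathbb{C}$, $e_n^*=(0,\dots,0,1)$, and $z$ is the block diagonal matrix with diagonal blocks $\begin{pmatrix}0&a_1\\-a_1&0\end{pmatrix},\dots,\begin{pmatrix}0&a_\ell\\-a_\ell&0\end{pmatrix}$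 followed by a $1\times1$ zero block, with $(a_1,\dots,a_\ell)\in\mathbb{C}^\ell$. The function $\varphi_\ell:\mathfrak{h}\to\mathbb{C}$ is $\varphi_\ell(z,ae_n^* )=a\,a_1a_2\cdots a_\ell$. *)

(* Defs.v *)
From HB Require Import structures.
From mathcomp Require Import all_boot all_order all_algebra all_fingroup.
From mathcomp Require Import reals complex mpoly ring.

Set Implicit Arguments.
Unset Strict Implicit.
Unset Printing Implicit Defensive.

Import Order.TTheory GRing.Theory Num.Theory.
Local Open Scope ring_scope.

Section SpecialOrthogonal.
Variables (F : numFieldType) (n : nat).

Definition skew : {pred 'M[F]_n} := fun A => A^T == - A.

Lemma skewE (A : 'M[F]_n) : (A \in skew) = (A^T == - A).
Proof. by []. Qed.

Fact skew_submod_closed : submod_closed skew.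
Proof.
split=> [|a A B]; rewrite !skewE; first by rewrite trmx0 oppr0.
move=> /eqP hA /eqP hB.
by rewrite linearP /= hA hB scalerN opprD.
Qed.
HB.instance Definition _ :=
  GRing.isSubmodClosed.Build F 'M[F]_n skew skew_submod_closed.

Record so := So { so_val :> 'M[F]_n; so_skew : so_val \in skew }.
HB.instance Definition _ := [isSub for so_val].
HB.instance Definition _ := [Choice of so by <:].
HB.instance Definition _ := [SubChoice_isSubLmodule of so by <:].

Record SO := MkSO
  { SO_val :> 'M[F]_n;
    SO_prop : (SO_val^T *m SO_val == 1%:M) && (\det SO_val == 1) }.
HB.instance Definition _ := [isSub for SO_val].
HB.instance Definition _ := [Choice of SO by <:].

Lemma SO_trmxM (g : SO) : g^T *m g = 1%:M.
Proof. by case/andP: (SO_prop g) => /eqP. Qed.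

Lemma SO_Mtrmx (g : SO) : g *m g^T = 1%:M.
Proof. exact: mulmx1C (SO_trmxM g). Qed.

Lemma SO_det (g : SO) : \det g = 1.
Proof. by case/andP: (SO_prop g) => _ /eqP. Qed.

Fact SO_one_prop : ((1%:M : 'M[F]_n)^T *m 1%:M == 1%:M) && (\det (1%:M : 'M[F]_n) == 1).
Proof. by rewrite trmx1 mulmx1 det1 !eqxx. Qed.

Fact SO_mul_prop (g h : SO) :
  ((g *m h)^T *m (g *m h) == 1%:M) && (\det (g *m h) == 1).
Proof.
rewrite trmx_mul mulmxA -(mulmxA h^T) SO_trmxM mulmx1 SO_trmxM.
by rewrite det_mulmx !SO_det mulr1 !eqxx.
Qed.

Fact SO_inv_prop (g : SO) : (g^T^T *m g^T == 1%:M) && (\det g^T == 1).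
Proof. by rewrite trmxK SO_Mtrmx det_tr SO_det !eqxx. Qed.

Definition SO_one := MkSO SO_one_prop.
Definition SO_mul g h := MkSO (SO_mul_prop g h).
Definition SO_inv g := MkSO (SO_inv_prop g).

Fact SO_mulA : associative SO_mul.
Proof. by move=> g h k; apply: val_inj; rewrite /= mulmxA. Qed.
Fact SO_mul1 : left_id SO_one SO_mul.
Proof. by move=> g; apply: val_inj; rewrite /= mul1mx. Qed.
Fact SO_mulr1 : right_id SO_one SO_mul.
Proof. by move=> g; apply: val_inj; rewrite /= mulmx1. Qed.
Fact SO_mulV : left_inverse SO_one SO_inv SO_mul.
Proof. by move=> g; apply: val_inj; rewrite /= SO_trmxM. Qed.
Fact SO_mulrV : right_inverse SO_one SO_inv SO_mul.
Proof. by move=> g; apply: val_inj; rewrite /= SO_Mtrmx. Qed.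
HB.instance Definition _ :=
  isGroup.Build SO SO_mulA SO_mul1 SO_mulr1 SO_mulV SO_mulrV.

Definition ISO : Type := (SO * 'cV[F]_n)%type.
HB.instance Definition _ := Choice.copy ISO (SO * 'cV[F]_n)%type.

Definition ISO_one : ISO := (SO_one, 0).
Definition ISO_mul (h k : ISO) : ISO := (SO_mul h.1 k.1, h.2 + h.1 *m k.2).
Definition ISO_inv (h : ISO) : ISO := (SO_inv h.1, - (SO_inv h.1 *m h.2)).

Fact ISO_mulA : associative ISO_mul.
Proof.
move=> [g u] [h v] [k w]; congr (_, _) => /=; first exact: SO_mulA.
by rewrite mulmxDr addrA mulmxA.
Qed.
Fact ISO_mul1 : left_id ISO_one ISO_mul.
Proof. by move=> [g u]; congr (_, _); rewrite /= ?SO_mul1 // mul1mx add0r. Qed.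
Fact ISO_mulr1 : right_id ISO_one ISO_mul.
Proof. by move=> [g u]; congr (_, _); rewrite /= ?SO_mulr1 // mulmx0 addr0. Qed.
Fact ISO_mulV : left_inverse ISO_one ISO_inv ISO_mul.
Proof. by move=> [g u]; congr (_, _); rewrite /= ?SO_mulV // addNr. Qed.
Fact ISO_mulrV : right_inverse ISO_one ISO_inv ISO_mul.
Proof.
move=> [g u]; congr (_, _); rewrite /= ?SO_mulrV //.
by rewrite mulmxN mulmxA SO_Mtrmx mul1mx subrr.
Qed.
HB.instance Definition _ :=
  isGroup.Build ISO ISO_mulA ISO_mul1 ISO_mulr1 ISO_mulV ISO_mulrV.

(* The Lie algebra c of ISO(n), and its dual, with the identification given
   by [pairing]. *)
Notation iso_lie := (so * 'cV[F]_n)%type.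
Notation iso_dual := (so * 'rV[F]_n)%type.

Definition pairing (lam : iso_dual) (X : iso_lie) : F :=
  \tr (lam.1 *m X.1) + 2 * (lam.2 *m X.2) 0 0.

Fact bracket_skew (x y : so) : x *m y - y *m x \in skew.
Proof.
rewrite skewE linearB /= !trmx_mul (eqP (so_skew x)) (eqP (so_skew y)).
by rewrite !mulNmx !mulmxN !opprK opprB.
Qed.

Definition bracket (X Y : iso_lie) : iso_lie :=
  (So (bracket_skew X.1 Y.1), X.1 *m Y.2 - Y.1 *m X.2).

Fact conj_skew (g : SO) (x : so) : g *m x *m g^T \in skew.
Proof.
by rewrite skewE !trmx_mul trmxK (eqP (so_skew x)) mulNmx mulmxN mulmxA.
Qed.

Definition conj_so (g : SO) (x : so) : so := So (conj_skew g x).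

(* The formula is conjugation in the affine matrix realization, see [affAd]
   below; [g^-1 = g^T] for [g] in SO(n). *)
Definition Ad (h : ISO) (X : iso_lie) : iso_lie :=
  let: (g, u) := h in let: (x, v) := X in
  (conj_so g x, g *m v - conj_so g x *m u).

Definition aff (h : ISO) : 'M[F]_(n + 1) := block_mx (SO_val h.1) h.2 0 1%:M.
Definition aff_lie (X : iso_lie) : 'M[F]_(n + 1) :=
  block_mx (so_val X.1) X.2 0 0.

Lemma affM (h k : ISO) : aff (h * k)%g = aff h *m aff k.
Proof.
rewrite /aff mulmx_block !mul0mx !mulmx0 !mulmx1 !addr0 add0r.
by rewrite [h.1 *m k.2 + _]addrC.
Qed.

Lemma aff_lie_bracket (X Y : iso_lie) :
  aff_lie (bracket X Y) = aff_lie X *m aff_lie Y - aff_lie Y *m aff_lie X.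
Proof.
rewrite /aff_lie !mulmx_block !mul0mx !mulmx0 !addr0.
by rewrite opp_block_mx add_block_mx !subr0.
Qed.

Lemma affAd (h : ISO) (X : iso_lie) :
  aff_lie (Ad h X) = aff h *m aff_lie X *m aff (h^-1)%g.
Proof.
case: h X => g u [x v].
rewrite [(_^-1)%g]/(ISO_inv (g, u)) /aff_lie /aff /= !mulmx_block.
rewrite !mul0mx !mulmx0 !mulmx1 !addr0.
by rewrite mulmxN !mulmxA [in RHS]addrC !(mul0mx _ g^T, mul0mx).
Qed.

Fact add_skew (x : so) (A : 'M[F]_n) : so_val x + (A - A^T) \in skew.
Proof.
apply: rpredD (so_skew x) _.
by rewrite skewE linearB /= trmxK opprB.
Qed.

(* Determined by [pairing_coAd] and [pairing_inj]. *)
Definition coAd (h : ISO) (lam : iso_dual) : iso_dual :=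
  let: (g, u) := h in let: (y, w) := lam in
  (So (add_skew (conj_so g y) (u *m (w *m g^T))), w *m g^T).

Lemma pairing_coAd (h : ISO) (lam : iso_dual) (X : iso_lie) :
  pairing (coAd h lam) X = pairing lam (Ad (h^-1)%g X).
Proof.
case: h lam X => g u [y w] [x v].
rewrite [(_^-1)%g]/(ISO_inv (g, u)) /pairing /=.
have tr1 (M : 'M[F]_1) : M 0 0 = \tr M by rewrite /mxtrace big_ord1.
rewrite !mulmxDl mulNmx !mxtraceD raddfN /= !tr1.
have -> : \tr ((u *m (w *m g^T))^T *m x) = - \tr (u *m (w *m g^T) *m x).
  rewrite -mxtrace_tr trmx_mul trmxK (eqP (so_skew x)) mulNmx raddfN /=.
  by rewrite mxtrace_mulC.
have -> : \tr (g *m y *m g^T *m x) = \tr (y *m (g^T *m x *m g^T^T)).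
  by rewrite trmxK -!mulmxA mxtrace_mulC !mulmxA.
have -> : \tr (u *m (w *m g^T) *m x) = \tr (w *m (g^T *m x *m u)).
  by rewrite -mulmxA mxtrace_mulC !mulmxA.
rewrite trmxK.
have -> : w *m (g^T *m v - g^T *m x *m g *m - (g^T *m u))
   = w *m g^T *m v + w *m (g^T *m x *m u).
  rewrite mulmxN opprK mulmxDr mulmxA; congr (_ + _ *m _).
  by rewrite mulmxA -[_ *m g *m _]mulmxA SO_Mtrmx mulmx1.
rewrite mxtraceD; ring.
Qed.

Lemma pairing_inj (lam mu : iso_dual) :
  (forall X, pairing lam X = pairing mu X) -> lam = mu.
Proof.
case: lam mu => [y w] [y' w'] eqXX.
have tr0 : \tr (0 : 'M[F]_n) = 0 by rewrite mxtrace0.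
congr (_, _); last first.
  apply/rowP => j; have := eqXX (0, delta_mx j 0); rewrite /pairing /=.
  rewrite !mulmx0 !mxtrace0 !add0r -!colE !mxE.
  by apply: mulfI; rewrite pnatr_eq0.
apply: val_inj; apply/matrixP => i j /=.
have skd : delta_mx j i - delta_mx i j \in skew.
  by rewrite skewE linearB /= !trmx_delta opprB.
have := eqXX (So skd, 0); rewrite /pairing /= !mulmx0 !mxE !mulr0 !addr0.
have trd (z : so) : \tr (z *m (delta_mx j i - delta_mx i j)) = 2 * z i j.
  have trA (A : 'M[F]_n) k l : \tr (A *m delta_mx k l) = A l k.
    rewrite /mxtrace (bigD1 l) //= big1 ?addr0 => [|a al].
      rewrite mxE (bigD1 k) //= big1 ?addr0 => [|b bk].
        by rewrite mxE !eqxx mulr1.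
      by rewrite mxE (negPf bk) mulr0.
    by rewrite mxE big1 // => b _; rewrite mxE (negPf al) andbF mulr0.
  rewrite mulmxBr linearB /= !trA.
  have /matrixP/(_ i j) := eqP (so_skew z); rewrite !mxE => ->; ring.
by rewrite !trd; apply: mulfI; rewrite pnatr_eq0.
Qed.

Lemma coAd1 (lam : iso_dual) : coAd 1%g lam = lam.
Proof.
apply: pairing_inj => X; rewrite pairing_coAd invg1; congr pairing.
case: X => x v; rewrite /Ad /=; congr (_, _); last first.
  by rewrite mulmx0 subr0 mul1mx.
by apply: val_inj; rewrite /= trmx1 mulmx1 mul1mx.
Qed.

Lemma coAdM (h k : ISO) (lam : iso_dual) :
  coAd (h * k)%g lam = coAd h (coAd k lam).
Proof.
apply: pairing_inj => X; rewrite !pairing_coAd; congr pairing.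
have aff_lie_inj Y Z : aff_lie Y = aff_lie Z -> Y = Z.
  case: Y Z => [y a] [z b] /eq_block_mx /= [yz -> _ _].
  by congr (_, _); apply: val_inj.
by apply: aff_lie_inj; rewrite !affAd !invgK invMg !affM !mulmxA.
Qed.

End SpecialOrthogonal.

Notation iso_lie F n := (so F n * 'cV[F]_n)%type.
Notation iso_dual F n := (so F n * 'rV[F]_n)%type.

(* Polynomial functions on V are the elements of the algebra of functions
   generated by the linear forms. *)
Definition polynomial_function (F : numFieldType) (V : lmodType F)
    (f : V -> F) : Prop :=
  exists (k : nat) (p : {mpoly F[k]}) (L : 'I_k -> {scalar V}),
    forall v, f v = p.@[fun i => L i v].

(* Membership in the algebra Y(c). *)
Definition in_Yc (F : numFieldType) (n : nat) (f : iso_dual F n -> F) : Prop :=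
  polynomial_function f /\ forall h lam, f (coAd h lam) = f lam.

Section CartanSlice.
Variables (F : numFieldType) (l : nat).
Implicit Types (b : 'rV[F]_l) (a : F).

Definition slice_mx b : 'M[F]_(l.*2.+1) :=
  \sum_(k < l) b 0 k *: (delta_mx (inord k.*2) (inord k.*2.+1)
                         - delta_mx (inord k.*2.+1) (inord k.*2)).

Fact slice_skew b : slice_mx b \in @skew F _.
Proof.
apply: rpred_sum => k _; apply: rpredZ.
by rewrite skewE linearB /= !trmx_delta opprB.
Qed.

(* The point (z, a e_n^* ) of h, where (a_1, ..., a_l) is [b]; the map
   [(b, a) |-> slice b a] parametrizes h. *)
Definition slice b a : iso_dual F l.*2.+1 :=
  (So (slice_skew b), a *: delta_mx 0 ord_max).

Definition slice_phi b a : F := a * \prod_(k < l) b 0 k.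

(* [slice_phi] is a function on h. *)
Lemma slice_inj b a b' a' : slice b a = slice b' a' -> b = b' /\ a = a'.
Proof.
have sliceE c (k : 'I_l) : slice_mx c (inord k.*2) (inord k.*2.+1) = c 0 k.
  have lt2 (i : 'I_l) : (i.*2.+1 < l.*2.+1)%N by rewrite ltnS ltn_double.
  rewrite /slice_mx summxE (bigD1 k) //= big1 ?addr0 => [|i ik].
    rewrite !mxE !eqxx -!val_eqE /= !inordK ?(ltnW (lt2 _)) ?lt2 //.
    by rewrite (ltn_eqF (ltnSn _)) subr0 mulr1.
  rewrite !mxE -!val_eqE /= !inordK ?(ltnW (lt2 _)) ?lt2 //.
  rewrite (inj_eq double_inj) val_eqE [k == i]eq_sym (negPf ik) /=.
  have -> : (k.*2 == i.*2.+1) = false.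
    by apply/eqP => /(congr1 odd); rewrite /= !odd_double.
  by rewrite subr0 mulr0.
move=> e; split.
  apply/rowP => k; rewrite -!sliceE.
  by have := congr1 (fun x : iso_dual F _ => so_val x.1) e; move=> /= ->.
have := congr1 (fun x : iso_dual F _ => x.2 0 ord_max) e.
by rewrite /= !mxE !eqxx !mulr1.
Qed.

End CartanSlice.

(* Pf(A) = 1/(2^m m!) sum_s sgn(s) prod_(k < m) A_(s(2k), s(2k+1)) with
   N = 2m and indices starting at 0. The index [p] below ranges over the pairs
   (2k, 2k+1); the value is meaningful only for [N] even. *)
Definition Pf (F : numFieldType) (N : nat) (A : 'M[F]_N) : F :=
  ((2 ^ N./2 * (N./2)`!)%:R)^-1 *
  \sum_(s : 'S_N) (-1) ^+ s *
    \prod_(p : 'I_N * 'I_N | ~~ odd p.1 && (p.2 == p.1.+1 :> nat))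
      A (s p.1) (s p.2).

Definition bordered (F : numFieldType) (n : nat) (lam : iso_dual F n) :
    'M[F]_(n + 1) :=
  block_mx (so_val lam.1) (- lam.2^T) lam.2 0.

Lemma bordered_skew (F : numFieldType) (n : nat) (lam : iso_dual F n) :
  bordered lam \in @skew F _.
Proof.
rewrite skewE tr_block_mx opp_block_mx opprK (eqP (so_skew _)) trmx0 oppr0.
by rewrite linearN /= trmxK.
Qed.

(* Main.v *)
Require Import Defs.
From HB Require Import structures.
From mathcomp Require Import all_boot all_order all_algebra all_fingroup.
From mathcomp Require Import reals complex mpoly zify ring.
Import Order.TTheory GRing.Theory Num.Theory.
Local Open Scope ring_scope.

Set Implicit Arguments.
Unset Strict Implicit.
Unset Printing Implicit Defensive.

(* The bordered matrix of [coAd (g, u) lam] is [M B M^T], where [B] is that of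
   [lam] and [M = [g u; 0 1]] has determinant 1, so [Pf (M B M^T) = det M Pf B]
   gives invariance. On the slice [B = D J D^T] with [J] the standard symplectic
   matrix and [D] diagonal, so the Pfaffian is [det D = - a a_1 ... a_l]: the
   sign is -1. For uniqueness, every real point of the dual is moved into the
   slice by a real element of ISO(n) (rotate [w], or a kernel vector of [y] if
   [w = 0], onto the last axis, kill the last row of [y] by a translation, put
   the rest in normal form), hence two invariants that agree on the slice agree
   at real points; on the complex line through two real points [A + t B] they
   are polynomials in [t] that agree for real [t], hence also for [t = i]. *)

(** * Pfaffians *)

Fact evo_subproof m (k : 'I_m) : (k.*2 < m.*2)%N.
Proof. by rewrite ltn_double. Qed.
Fact odo_subproof m (k : 'I_m) : (k.*2.+1 < m.*2)%N.
Proof. by rewrite -doubleS leq_double. Qed.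
(** [evo k] = 2k and [odo k] = 2k+1 are the members of the k-th pair in the Pfaffian; [hlf] below
    inverts both. *)
Definition evo m (k : 'I_m) : 'I_m.*2 := Ordinal (evo_subproof k).
Definition odo m (k : 'I_m) : 'I_m.*2 := Ordinal (odo_subproof k).

Lemma evo_recl m (k : 'I_m) : evo (lift ord0 k) = lift ord0 (lift ord0 (evo k)).
Proof. exact: val_inj. Qed.
Lemma odo_recl m (k : 'I_m) : odo (lift ord0 k) = lift ord0 (lift ord0 (odo k)).
Proof. exact: val_inj. Qed.

Lemma prod_evo_odo (R : comPzRingType) m (F : 'I_m.*2 -> R) :
  \prod_i F i = \prod_(k < m) (F (evo k) * F (odo k)).
Proof.
elim: m F => [|m IHm] F; first by rewrite !big_ord0.
rewrite !big_ord_recl IHm mulrA; congr (F _ * F _ * _); try exact: val_inj.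
by apply: eq_bigr => k _; rewrite evo_recl odo_recl.
Qed.

(** Sorts permutations by the image [i] of 0. The reindexing is injective, and (n+1)! = (n+1) n!
    makes it bijective. *)
Lemma sum_lift_perm (V : nmodType) n (F : 'S_n.+1 -> V) :
  \sum_s F s = \sum_i \sum_(s : 'S_n) F (lift_perm ord0 i s).
Proof.
rewrite pair_big (reindex (fun p : 'I_n.+1 * 'S_n => lift_perm ord0 p.1 p.2)) //.
apply/onW_bij/inj_card_bij => [[i s] [j t] /= e|]; last first.
  by rewrite card_prod card_ord !card_Sn factS.
have eij : i = j by move/permP/(_ ord0): e; rewrite !lift_perm_id.
subst j; congr (_, _); apply/permP => k.
by move/permP/(_ (lift ord0 k)): e; rewrite !lift_perm_lift => /lift_inj.
Qed.

Fact hlf_subproof m (i : 'I_m.*2) : (i./2 < m)%N.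
Proof. by rewrite ltn_half_double. Qed.
Definition hlf m (i : 'I_m.*2) : 'I_m := Ordinal (hlf_subproof i).

Lemma hlf_evo m (k : 'I_m) : hlf (evo k) = k.
Proof. by apply: val_inj; rewrite /= doubleK. Qed.
Lemma hlf_odo m (k : 'I_m) : hlf (odo k) = k.
Proof. by apply: val_inj; rewrite /= uphalf_double. Qed.

(** The partner of [i] in its pair is [i+1] or [i-1], and [bump i] takes that value exactly at
    [i./2.*2]. The two components are the two conditions for a nonzero entry of [std_symplectic]. *)
Lemma bump_unpaired i j : j <> i./2.*2 ->
  (~~ odd i && (bump i j == i.+1) = false) *
  (~~ odd (bump i j) && (i == (bump i j).+1) = false).
Proof. by rewrite /bump => ji; split; case: (leqP i j) => /= h; lia. Qed.

Lemma bump_paired i j : j = i./2.*2 ->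
  (~~ odd i && (bump i j == i.+1) = ~~ odd i) *
  (~~ odd (bump i j) && (i == (bump i j).+1) = odd i).
Proof. by rewrite /bump => ->; split; case: leqP => /= h; lia. Qed.

(** The map [b] skips both members of the pair of [i], so it shifts by 0 or 2 and respects the
    division into pairs. *)
Lemma bump_bump_paired i x y (b := fun z => bump i (bump i./2.*2 z)) :
  ~~ odd (b x) && (b y == (b x).+1) = ~~ odd x && (y == x.+1).
Proof.
rewrite /b /bump; case: (leqP i./2.*2 x) => h; case: (leqP i./2.*2 y) => h';
do 2!case: leqP => /=; lia.
Qed.

Section Pfaffian.
Variable F : numFieldType.

Definition Pf_sum m (A : 'M[F]_m.*2) : F :=
  \sum_(s : 'S_m.*2) (-1) ^+ s * \prod_(k < m) A (s (evo k)) (s (odo k)).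

Lemma PfE m (A : 'M[F]_m.*2) : Pf A = ((2 ^ m * m`!)%:R)^-1 * Pf_sum A.
Proof.
rewrite /Pf doubleK; congr (_ * _); apply: eq_bigr => s _; congr (_ * _).
pose h k := (evo k, odo k) : 'I_m.*2 * 'I_m.*2.
rewrite (reindex_onto h (fun p => hlf p.1)) /=.
  apply: eq_bigl => k; rewrite /h /= odd_double eqxx /=.
  by rewrite hlf_evo eqxx.
move=> [i j] /= /andP[Ni /eqP ji]; congr (_, _); apply: val_inj => /=.
  by rewrite even_halfK.
by rewrite even_halfK.
Qed.

(** Expanding every entry of the product picks an index pair [f k] in each factor. After exchanging
    sums, the signed sum over [s] for fixed [f] is the Leibniz formula. *)
Lemma Pf_sum_expand m (M A : 'M[F]_m.*2) :
  Pf_sum (M *m A *m M^T) =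
  \sum_(f : {ffun 'I_m -> 'I_m.*2 * 'I_m.*2})
    \prod_k A (f k).1 (f k).2 *
    \det (\matrix_(i, j)
      M j (if odd i then (f (hlf i)).2 else (f (hlf i)).1)).
Proof.
rewrite /Pf_sum.
transitivity (\sum_(s : 'S_m.*2) \sum_(f : {ffun 'I_m -> 'I_m.*2 * 'I_m.*2})
   (-1) ^+ s * \prod_k (A (f k).1 (f k).2 *
     (M (s (evo k)) (f k).1 * M (s (odo k)) (f k).2))).
  apply: eq_bigr => s _; rewrite -big_distrr; congr (_ * _).
  rewrite -(bigA_distr_bigA (fun k p => A p.1 p.2 *
     (M (s (evo k)) p.1 * M (s (odo k)) p.2))) /=.
  apply: eq_bigr => k _; rewrite !mxE.
  transitivity (\sum_j \sum_i M (s (evo k)) i * A i j * M (s (odo k)) j).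
    by apply: eq_bigr => j _; rewrite !mxE big_distrl.
  rewrite exchange_big pair_big /=; apply: eq_bigr => p _.
  by rewrite [_ * A _ _]mulrC mulrA.
rewrite exchange_big; apply: eq_bigr => f _.
rewrite /determinant big_distrr; apply: eq_bigr => s _ /=.
rewrite big_split mulrCA; congr (_ * (_ * _)).
rewrite prod_evo_odo; apply: eq_bigr => k _; rewrite !mxE /=.
by rewrite odd_double /= hlf_evo hlf_odo.
Qed.

(* Every determinant in [Pf_sum_expand] is that of a selection matrix times
   [M^T]; the same expansion for [M = 1] recovers [Pf_sum A]. *)
Lemma Pf_sum_congr m (M A : 'M[F]_m.*2) :
  Pf_sum (M *m A *m M^T) = \det M * Pf_sum A.
Proof.
have -> : Pf_sum A = Pf_sum (1%:M *m A *m 1%:M^T) by rewrite trmx1 mul1mx mulmx1.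
rewrite !Pf_sum_expand big_distrr /=; apply: eq_bigr => f _.
rewrite mulrCA; congr (_ * _).
rewrite -(det_tr M) mulrC -det_mulmx; congr (\det _).
apply/matrixP => i j; rewrite !mxE.
set g := if odd i then _ else _.
rewrite (bigD1 g) //= big1 => [|k kg]; last first.
  by rewrite !mxE (negPf kg) mul0r.
by rewrite !mxE eqxx mul1r addr0.
Qed.

Lemma Pf_congr N (M A : 'M[F]_N) :
  ~~ odd N -> Pf (M *m A *m M^T) = \det M * Pf A.
Proof.
move=> /even_halfK; move: (N./2) => m mN; case: _ / mN in M A *.
by rewrite !PfE Pf_sum_congr mulrCA.
Qed.

(** Blocks (0 1; -1 0) down the diagonal, to match the blocks of the slice. *)
Definition std_symplectic N : 'M[F]_N :=
  \matrix_(i, j) (if ~~ odd i && (j == i.+1 :> nat) then 1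
                  else if ~~ odd j && (i == j.+1 :> nat) then -1 else 0).

(* [t] is a permutation with [t 0 = i] and [t 1 = lift i j]; the term vanishes
   unless [t] maps the pair {0, 1} onto a pair {2k, 2k+1}. *)
Lemma prod_std_symplectic m (i : 'I_m.+1.*2) (j : 'I_m.*2.+1) (s : 'S_m.*2) :
  let t := lift_perm ord0 i (lift_perm ord0 j s) in
  (-1) ^+ t * \prod_(k < m.+1) std_symplectic _ (t (evo k)) (t (odo k)) =
  if j == i./2.*2 :> nat
  then (-1) ^+ s * \prod_(k < m) std_symplectic _ (s (evo k)) (s (odo k))
  else 0.
Proof.
move=> t; rewrite big_ord_recl.
have t0 : t (evo ord0) = i.
  by rewrite /t (_ : evo ord0 = ord0) ?lift_perm_id //; apply: val_inj.
have t1 : t (odo ord0) = lift i j.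
  rewrite /t (_ : odo ord0 = lift ord0 ord0); last exact: val_inj.
  by rewrite lift_perm_lift lift_perm_id.
have t2 k : t (lift ord0 (lift ord0 k)) = lift i (lift j (s k)).
  by rewrite /t !lift_perm_lift.
under eq_bigr => k _ do rewrite evo_recl odo_recl !t2.
rewrite t0 t1.
have tE : (-1) ^+ t = (-1) ^+ (odd i (+) odd j) * (-1) ^+ s :> F.
  by rewrite -signr_addb /t !odd_lift_perm /= addbA.
rewrite tE; case: eqP => [ji|ji]; last first.
  rewrite (_ : std_symplectic _ i (lift i j) = 0) ?mul0r ?mulr0 //.
  rewrite mxE /=; have [b1 b2] := bump_unpaired ji.
  by rewrite b1 b2.
have -> : std_symplectic _ i (lift i j) = (-1) ^+ odd i.
  rewrite mxE /=; have [b1 b2] := bump_paired ji; rewrite b1 b2.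
  by case: (odd i).
have -> : odd j = false by rewrite ji odd_double.
(* The parity of [i] enters through the sign of [t] and through the entry at its pair, and
   cancels. *)
rewrite addbF mulrACA -expr2 sqrr_sign mul1r; congr (_ * _).
apply: eq_bigr => k _; rewrite !mxE /= ji.
by rewrite !bump_bump_paired.
Qed.

(** Each of the 2(m+1) values of [i] admits exactly one contributing [j], so the induction step
    multiplies the sum by 2(m+1). *)
Lemma Pf_sum_std m : Pf_sum (std_symplectic m.*2) = (2 ^ m * m`!)%:R.
Proof.
elim: m => [|m IHm].
  rewrite /Pf_sum (eq_bigr (fun=> 1)) => [|s _].
    by rewrite sumr_const card_Sn.
  by rewrite big_ord0 mulr1 (_ : s = 1%g) ?odd_perm1 //; apply/permP => -[].
rewrite /Pf_sum sum_lift_perm.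
have -> : (2 ^ m.+1 * (m.+1)`!)%:R = \sum_(i < m.+1.*2) (2 ^ m * m`!)%:R :> F.
  rewrite sumr_const card_ord -mulrnA; congr _%:R.
  by rewrite factS expnS -muln2 mulnACA [RHS]mulnC [(2 * _)%N]mulnC.
apply: eq_bigr => i _; rewrite sum_lift_perm.
under eq_bigr => j _ do under eq_bigr => s _ do rewrite prod_std_symplectic.
have ltj : (i./2.*2 < m.*2.+1)%N.
  by rewrite ltnS leq_double; exact: (@hlf_subproof m.+1 i).
rewrite (bigD1 (Ordinal ltj)) //= eqxx -[RHS]IHm.
rewrite [X in _ + X]big1 ?addr0 // => j /negPf nj; rewrite big1 // => s _.
by rewrite -[_ == _ :> nat]/(j == Ordinal ltj) nj.
Qed.

Lemma Pf_std N : ~~ odd N -> Pf (std_symplectic N) = 1.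
Proof.
move=> /even_halfK <-; rewrite PfE Pf_sum_std mulVf //.
by rewrite pnatr_eq0 -lt0n muln_gt0 expn_gt0 fact_gt0.
Qed.
End Pfaffian.

(** * Bordered matrices: invariance, values on the slice, polynomiality *)

Section Bordered.
Variable F : numFieldType.

Lemma bordered_coAd n (h : ISO F n) (lam : iso_dual F n) :
  let M := block_mx (SO_val h.1) h.2 0 (1%:M : 'M_1) in
  bordered (coAd h lam) = M *m bordered lam *m M^T.
Proof.
case: h lam => g u [y w] /=.
rewrite /bordered /= tr_block_mx trmx0 trmx1 !mulmx_block.
rewrite !(mul0mx, mulmx0, mul1mx, mulmx1, addr0, add0r).
rewrite !trmx_mul !trmxK mulmxN !mulmxDl mulNmx !mulmxA addrA.
congr (block_mx _ _ _ _).
Qed.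

Lemma Pf_bordered_coAd n (h : ISO F n) (lam : iso_dual F n) :
  odd n -> Pf (bordered (coAd h lam)) = Pf (bordered lam).
Proof.
move=> on; rewrite bordered_coAd Pf_congr ?addn1 /= ?on //.
by rewrite det_ublock SO_det det1 !mul1r.
Qed.

Lemma std_symplecticE N (i j : 'I_N) :
  std_symplectic F N i j = (~~ odd i && (j == i.+1 :> nat))%:R
                           - (~~ odd j && (i == j.+1 :> nat))%:R.
Proof.
rewrite mxE; case: (boolP (~~ odd i && _)) => [/andP[oi /eqP ji]|_].
  by rewrite ji /= oi /= subr0.
by rewrite /= sub0r; case: ifP => _; rewrite ?oppr0.
Qed.

(** The default 0 is reached only at [i = 2l], the final 1 x 1 zero block. *)
Lemma slice_mxE l (b : 'rV[F]_l) i j :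
  slice_mx b i j =
  (if insub i./2 is Some k then b 0 k else 0) * std_symplectic F _ i j.
Proof.
rewrite /slice_mx summxE std_symplecticE.
transitivity (\sum_(k < l | i./2 == k)
   b 0 k * ((~~ odd i && (j == i.+1 :> nat))%:R
            - (~~ odd j && (i == j.+1 :> nat))%:R)).
  rewrite [RHS]big_mkcond; apply: eq_bigr => k _; rewrite !mxE -!val_eqE /=.
  have ltk := ltn_ord k.
  rewrite !inordK; try lia.
  have -> : (i == k.*2 :> nat) && (j == k.*2.+1 :> nat) =
            (i./2 == k) && (~~ odd i && (j == i.+1 :> nat)) by lia.
  have -> : (i == k.*2.+1 :> nat) && (j == k.*2 :> nat) =
            (i./2 == k) && (~~ odd j && (i == j.+1 :> nat)) by lia.
  by case: ifP => //= _; rewrite subr0 mulr0.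
rewrite -big_distrl; congr (_ * _).
case: insubP => [k ltk ek|geil].
  by rewrite (big_pred1 k) // => k' /=; rewrite -ek eq_sym val_eqE.
rewrite big1 // => k /eqP ek; by rewrite ek ltn_ord in geil.
Qed.

(** Diagonal of [D]: each pair carries its coefficient at the even index and 1 at the odd one. The
    last pair (2l, 2l+1) meets the border, where the entry is [- a]; the default serves [i = 2l]. *)
Definition slice_weight l (b : 'rV[F]_l) (a : F) (i : nat) : F :=
  if odd i then 1 else if insub i./2 is Some k then b 0 k else - a.

Lemma bordered_slice l (b : 'rV[F]_l) a :
  let D := diag_mx (\row_(i < l.*2.+1 + 1) slice_weight b a i) in
  bordered (slice b a) = D *m std_symplectic F _ *m D^T.
Proof.
move=> D; apply/matrixP => i j.
rewrite /D tr_diag_mx mul_mx_diag [RHS]mxE mul_diag_mx [X in X * _]mxE.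
rewrite [X in _ * X]mxE [X in X * _ * _]mxE.
rewrite -(splitK i) -(splitK j) /bordered /slice_weight.
have insubl k : (l <= k)%N -> insub k = None :> option 'I_l.
  by rewrite leqNgt => ?; rewrite insubN.
case: (split i) => i'; case: (split j) => j' /=.
- rewrite block_mxEul /= slice_mxE !std_symplecticE /=.
  (* In the block of [y] only neighbouring indices contribute, [j' = i' + 1] or [i' = j' + 1]. *)
  have [ji|ji] := eqVneq (j' : nat) i'.+1.
    have lti : (i'./2 < l)%N by have := ltn_ord j'; rewrite ji; lia.
    rewrite ji /= (_ : (i' == i'.+2 :> nat) = false) ?andbF ?subr0; last lia.
    by rewrite insubT /=; case: (odd i') => /=; rewrite ?mulr0 ?mul0r ?mulr1.
  have [ij|ij] := eqVneq (i' : nat) j'.+1; last first.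
    by rewrite !andbF subrr mulr0 mulr0 mul0r.
  have ltj : (j'./2 < l)%N by have := ltn_ord i'; rewrite ij; lia.
  rewrite ij andbT andbF sub0r /=.
  rewrite uphalf_half; case: (odd j') => /=; first by rewrite oppr0 !mulr0 mul0r.
  by rewrite add0n insubT /= mul1r mulrC.
- have -> : j' = ord0 by exact: ord1.
  rewrite block_mxEur std_symplecticE !mxE /= !addn0 -val_eqE odd_double /=.
  rewrite eqSS eq_sym subr0 mulr1.
  have [->|il] := eqVneq (i' : nat) l.*2; last by rewrite andbF !mulr0 oppr0.
  by rewrite odd_double /= doubleK insubl // !mulr1.
- have -> : i' = ord0 by exact: ord1.
  rewrite block_mxEdl std_symplecticE !mxE /= !addn0 -val_eqE odd_double /=.
  rewrite eqSS [l.*2 == _]eq_sym sub0r mul1r.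
  have [->|il] := eqVneq (j' : nat) l.*2; last by rewrite andbF !mulr0 oppr0 mul0r.
  by rewrite odd_double /= doubleK insubl // mulr1 mulN1r opprK.
- have -> : i' = ord0 by exact: ord1.
  have -> : j' = ord0 by exact: ord1.
  rewrite block_mxEdr std_symplecticE mxE /= !addn0 odd_double /=.
  by rewrite subr0 mulr0 mul0r.
Qed.

Lemma det_slice_weight l (b : 'rV[F]_l) a :
  \det (diag_mx (\row_(i < l.*2.+1 + 1) slice_weight b a i)) =
  - slice_phi b a.
Proof.
rewrite det_diag (eq_bigr (fun i : 'I__ => slice_weight b a i)) => [|i _].
  rewrite -(big_mkord xpredT (slice_weight b a)) addn1 -doubleS big_mkord.
  rewrite prod_evo_odo big_ord_recr /= /slice_weight /= odd_double /= doubleK.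
  rewrite insubN ?ltnn // mulr1 mulrN mulrC; congr (- (_ * _)).
  apply: eq_bigr => k _; rewrite /= !odd_double /= mulr1 doubleK.
  by rewrite insubT // => ltk; congr (b _ _); apply: val_inj.
by rewrite mxE.
Qed.

Lemma Pf_bordered_slice l (b : 'rV[F]_l) a :
  Pf (bordered (slice b a)) = - slice_phi b a.
Proof.
have eN : ~~ odd (l.*2.+1 + 1) by rewrite addn1 /= odd_double.
by rewrite bordered_slice Pf_congr // Pf_std // mulr1 det_slice_weight.
Qed.

(** These are the linear forms in which the Pfaffian is a polynomial, flattened by [mxvec] to a
    single index. *)
Definition bordered_entry n (k : 'I_((n + 1) * (n + 1))) (lam : iso_dual F n) : F :=
  mxvec (bordered lam) 0 k.

Fact bordered_entry_linear n k : scalar (@bordered_entry n k).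
Proof.
move=> c lam mu; rewrite /bordered_entry.
have -> : bordered (c *: lam + mu) = c *: bordered lam + bordered mu.
  rewrite /bordered scale_block_mx add_block_mx /= linearP /=.
  by rewrite scalerN opprD scaler0 addr0.
by rewrite linearP !mxE.
Qed.
HB.instance Definition _ n k :=
  GRing.isLinear.Build F _ _ _ (@bordered_entry n k) (@bordered_entry_linear n k).

Lemma polynomial_function_Pf_bordered n (c : F) :
  polynomial_function (fun lam : iso_dual F n => c * Pf (bordered lam)).
Proof.
pose X i j : {mpoly F[(n + 1) * (n + 1)]} := 'X_(mxvec_index i j).
exists _, ((c * ((2 ^ (n + 1)./2 * ((n + 1)./2)`!)%:R)^-1) *:
  \sum_(s : 'S_(n + 1)) (-1) ^+ s *:
    \prod_(p : 'I_(n + 1) * 'I_(n + 1) | ~~ odd p.1 && (p.2 == p.1.+1 :> nat))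
       X (s p.1) (s p.2)), (fun k => bordered_entry k : {scalar _}) => lam.
rewrite mevalZ -mulrA rmorph_sum; congr (_ * (_ * _)).
apply: eq_bigr => s _; rewrite /= mevalZ rmorph_prod; congr (_ * _).
by apply: eq_bigr => p _; rewrite /= mevalXU /= /bordered_entry mxvecE.
Qed.

End Bordered.

(** * Orthogonal normal form of a real skew matrix *)

(** Determinant -1 is allowed, since the normal form is built from reflections; [exists_rotation]
    corrects the determinant. *)
Definition orthogonal_mx (F : pzRingType) n (H : 'M[F]_n) := H *m H^T = 1%:M.

Lemma orthogonal_mxM (F : comPzRingType) n (G H : 'M[F]_n) :
  orthogonal_mx G -> orthogonal_mx H -> orthogonal_mx (G *m H).
Proof.
by move=> oG oH; rewrite /orthogonal_mx trmx_mul mulmxA -(mulmxA G) oH mulmx1.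
Qed.

Lemma orthogonal_block_mx (F : pzRingType) m n (G : 'M[F]_m) (H : 'M[F]_n) :
  orthogonal_mx G -> orthogonal_mx H -> orthogonal_mx (block_mx G 0 0 H).
Proof.
move=> oG oH; rewrite /orthogonal_mx tr_block_mx !trmx0 mulmx_block.
by rewrite !mulmx0 !mul0mx !addr0 add0r oG oH -scalar_mx_block.
Qed.

Lemma orthogonal_mx_tr (F : comUnitRingType) n (H : 'M[F]_n) :
  orthogonal_mx H -> H^T *m H = 1%:M.
Proof. exact: mulmx1C. Qed.

Section RealSkew.
Variable R : rcfType.

Lemma mulmx_tr_eq0 n (u : 'rV[R]_n) : (u *m u^T == 0) = (u == 0).
Proof.
apply/eqP/eqP => [|->]; last by rewrite mul0mx.
move=> /matrixP/(_ 0 0); rewrite !mxE => /eqP.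
rewrite psumr_eq0 => [/allP u0|j _]; last by rewrite mxE -expr2 sqr_ge0.
apply/rowP => j; have := u0 j (mem_index_enum _).
by rewrite !mxE -expr2 sqrf_eq0 => /eqP.
Qed.

Lemma exists_unit_scale n (v : 'rV[R]_n) : v != 0 ->
  exists2 c, c != 0 & (c *: v) *m (c *: v)^T = 1%:M.
Proof.
move=> v0; set s := (v *m v^T) 0 0.
have s0 : 0 < s.
  rewrite lt_def; apply/andP; split.
    rewrite -mulmx_tr_eq0 in v0; apply: contra v0 => /eqP s0.
    by rewrite [_ *m _]mx11_scalar -/s s0 raddf0.
  by rewrite /s mxE sumr_ge0 // => j _; rewrite mxE -expr2 sqr_ge0.
exists (Num.sqrt s)^-1; first by rewrite invr_eq0 gt_eqF // sqrtr_gt0.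
rewrite linearZ -scalemxAl -scalemxAr /= scalerA [v *m _]mx11_scalar -/s.
by rewrite -invfM -expr2 sqr_sqrtr ?ltW // scale_scalar_mx mulVf ?gt_eqF.
Qed.

(** The reflection along [u = e - p] exchanges the unit vectors [e] and [p]; when [e = p] the
    identity serves. *)
Lemma householder n (p : 'rV[R]_n.+1) : p *m p^T = 1%:M ->
  exists2 H, orthogonal_mx H & row 0 H = p.
Proof.
move=> p1; pose e : 'rV[R]_n.+1 := delta_mx 0 0.
have e1 : e *m e^T = 1%:M.
  by rewrite trmx_delta mul_delta_mx; apply/matrixP => i j; rewrite !ord1 !mxE.
have [ep|ep] := eqVneq e p.
  exists 1%:M; first by rewrite /orthogonal_mx trmx1 mulmx1.
  by rewrite row1.
pose u := e - p; pose c := (u *m u^T) 0 0.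
have uc : u *m u^T = c%:M by rewrite [LHS]mx11_scalar.
have c0 : c != 0.
  apply: contra ep => /eqP c0; rewrite -subr_eq0 -mulmx_tr_eq0.
  by rewrite -/u uc c0 raddf0.
have pe : p *m e^T = e *m p^T.
  apply: trmx_inj; rewrite trmx_mul trmxK.
  by apply/matrixP => i j; rewrite !mxE !ord1; apply: eq_bigr => k _; rewrite !mxE.
(* As [e] and [p] have equal length, twice the product of [e] with [u] is the squared length of
   [u]. *)
have eu : 2 *: (e *m u^T) = c%:M.
  rewrite -uc /u linearB /= mulmxBl !mulmxBr e1 p1 pe.
  rewrite opprB addrA -[_ - _ + 1%:M]addrA [- _ + _]addrC !addrA.
  by rewrite scalerBr !scaler_nat !mulr2n opprD !addrA -addrA [_ + 1%:M]addrC.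
pose P := u^T *m u; pose k := 2 / c.
have PP : P *m P = c *: P.
  by rewrite /P mulmxA -(mulmxA u^T) uc scalar_mxC mul_scalar_mx -scalemxAl.
exists (1%:M - k *: P).
  rewrite /orthogonal_mx; have -> : (1%:M - k *: P)^T = 1%:M - k *: P.
    by rewrite linearB /= linearZ /= trmx1 /P trmx_mul trmxK.
  rewrite mulmxBl !mulmxBr !mul1mx mulmx1 -scalemxAl -scalemxAr.
  rewrite PP !scalerA -addrA -opprD -scalerBl -scalerDl.
  rewrite (_ : k + _ = 0) ?scale0r ?subr0 // /k.
  by field.
rewrite rowE -/e mulmxBr mulmx1 -scalemxAr /P mulmxA /k mulrC -scalerA.
rewrite scalemxAl eu mul_scalar_mx scalerA mulVf // scale1r.
by rewrite /u opprB addrCA subrr addr0.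
Qed.

Lemma unit_row_mul n (H : 'M[R]_n.+1) (p : 'rV[R]_n.+1) :
  orthogonal_mx H -> row 0 H = p -> p *m H^T = delta_mx 0 0.
Proof. by move=> oH <-; rewrite -row_mul oH row1. Qed.

Lemma skew_det0 n (z : 'M[R]_n) : odd n -> z^T = - z -> \det z = 0.
Proof.
move=> on zT; have := det_tr z; rewrite zT -scaleN1r detZ -signr_odd on.
by rewrite mulN1r => /eqP; rewrite eq_sym -addr_eq0 -mulr2n mulrn_eq0 => /eqP.
Qed.

(** The first row of [K] is [r] normalised or, if [r = 0], a unit kernel vector of [z], which exists
    because a skew matrix of odd size is singular. *)
Lemma exists_adapted_orthogonal_mx n (z : 'M[R]_n.+1) (r : 'rV[R]_n.+1) :
  odd n.+1 -> z^T = - z ->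
  exists K c, [/\ orthogonal_mx K, r = c *: row 0 K & c = 0 -> row 0 K *m z = 0].
Proof.
move=> on zT; have [r0|r0] := eqVneq r 0.
  have /det0P[v v0 vz] : \det z == 0 by rewrite skew_det0.
  have [c c0 /householder[K oK K0]] := exists_unit_scale v0.
  exists K, 0; split=> // [|_]; first by rewrite r0 scale0r.
  by rewrite K0 -scalemxAl vz scaler0.
have [c c0 /householder[K oK K0]] := exists_unit_scale r0.
exists K, c^-1; split=> //.
  by rewrite K0 scalerA mulVf // scale1r.
by move/eqP; rewrite invr_eq0 (negPf c0).
Qed.

Lemma skew_mx11 (A : 'M[R]_1) : A^T = - A -> A = 0.
Proof.
move/matrixP/(_ 0 0)/eqP; rewrite !mxE -addr_eq0 -mulr2n mulrn_eq0 => /eqP A0.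
by apply/matrixP => i j; rewrite !ord1 A0 mxE.
Qed.

Lemma skew_row_mul0 n (y : 'M[R]_n) (a : 'rV[R]_n) : y^T = - y ->
  a *m y *m a^T = 0.
Proof.
move=> yT; apply: skew_mx11.
by rewrite !trmx_mul trmxK yT mulNmx mulmxN mulmxA.
Qed.

(* If [v = a + b i] is a complex eigenvector of [y] with eigenvalue [s + t i],
   skewness forces [s = 0], so [a] and [b] are eigenvectors of [y ^ 2] for
   [- t ^ 2]. *)
Lemma skew_sq_eigenvector n (y : 'M[R]_n.+1) : y^T = - y ->
  exists p t, p *m p^T = 1%:M :> 'M_1 /\ p *m y *m y = t *: p.
Proof.
move=> yT; pose yC := map_mx (real_complex R) y.
have /closed_rootP : size (char_poly yC) != 1%N by rewrite size_char_poly.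
case=> mu; rewrite -eigenvalue_root_char => /eigenvalueP[v v_eig v0].
pose a := map_mx (@complex.Re R) v; pose b := map_mx (@complex.Im R) v.
pose s := complex.Re mu; pose t := complex.Im mu.
have ReM (x : R[i]) (d : R) : complex.Re (x * real_complex R d) = complex.Re x * d.
  by case: x => x1 x2 /=; rewrite mulr0 subr0.
have ImM (x : R[i]) (d : R) : complex.Im (x * real_complex R d) = complex.Im x * d.
  by case: x => x1 x2 /=; rewrite mulr0 add0r.
have a_eig : a *m y = s *: a - t *: b.
  apply/rowP => j; move/rowP/(_ j)/(congr1 (@complex.Re R)): v_eig.
  rewrite !mxE (raddf_sum (@complex.Re R : Rcomplex R -> R)) /= => e.
  rewrite (eq_bigr (fun k => complex.Re (v 0 k * yC k j))) => [|k _].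
    by rewrite e /s /t; case: (mu) => m1 m2; case: (v 0 j).
  by rewrite !mxE ReM.
have b_eig : b *m y = s *: b + t *: a.
  apply/rowP => j; move/rowP/(_ j)/(congr1 (@complex.Im R)): v_eig.
  rewrite !mxE (raddf_sum (@complex.Im R : Rcomplex R -> R)) /= => e.
  rewrite (eq_bigr (fun k => complex.Im (v 0 k * yC k j))) => [|k _].
    by rewrite e /s /t; case: (mu) => m1 m2; case: (v 0 j).
  by rewrite !mxE ImM.
have ab0 : row_mx a b != 0.
  apply: contra v0; rewrite -[X in _ == X]row_mx0 => /eqP/eq_row_mx[a0 b0].
  apply/eqP/rowP => j; move/rowP/(_ j): a0; move/rowP/(_ j): b0.
  by rewrite !mxE; case: (v 0 j) => x1 x2 /= -> ->.
have s0 : s = 0.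
  have ba : b *m a^T = a *m b^T.
    rewrite -[LHS]trmxK trmx_mul trmxK.
    by apply/matrixP => i j; rewrite mxE !ord1.
  have := skew_row_mul0 a yT; rewrite a_eig mulmxBl -!scalemxAl ba => ha.
  have := skew_row_mul0 b yT; rewrite b_eig mulmxDl -!scalemxAl => hb.
  (* Adding the two identities cancels the terms in [t] and leaves [s (|a|^2 + |b|^2) = 0]. *)
  have : s *: (row_mx a b *m (row_mx a b)^T) = 0.
    rewrite tr_row_mx mul_row_col scalerDr.
    by move/eqP: ha; rewrite subr_eq0 => /eqP ->; rewrite addrC.
  by move/eqP; rewrite scaler_eq0 mulmx_tr_eq0 (negPf ab0) orbF => /eqP.
have [q q0 qyy] : exists2 q : 'rV_n.+1, q != 0 & q *m y *m y = (- t ^+ 2) *: q.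
  have ayy : a *m y *m y = (- t ^+ 2) *: a.
    rewrite a_eig s0 scale0r sub0r mulNmx -scalemxAl b_eig s0 scale0r add0r.
    by rewrite scalerA scaleNr expr2.
  have byy : b *m y *m y = (- t ^+ 2) *: b.
    rewrite b_eig s0 scale0r add0r -scalemxAl a_eig s0 scale0r sub0r scalerN.
    by rewrite scalerA scaleNr expr2.
  have [a0|a0] := eqVneq a 0; last by exists a.
  exists b => //; apply: contra ab0 => /eqP b0.
  by rewrite a0 b0 row_mx0.
have [c c0 cq] := exists_unit_scale q0.
exists (c *: q), (- t ^+ 2); split=> //.
by rewrite -!scalemxAl qyy !scalerA mulrC.
Qed.

Lemma skew_conj n (y G : 'M[R]_n) : y^T = - y ->
  (G *m y *m G^T)^T = - (G *m y *m G^T).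
Proof. by move=> yT; rewrite !trmx_mul trmxK yT mulNmx mulmxN mulmxA. Qed.

Lemma skew_submx m n (A : 'M[R]_(m + n)) : A^T = - A ->
  [/\ (ulsubmx A)^T = - ulsubmx A, (drsubmx A)^T = - drsubmx A &
      dlsubmx A = - (ursubmx A)^T].
Proof.
move=> /matrixP AT.
have entry i j : A j i = - A i j by have := AT i j; rewrite !mxE.
by split; apply/matrixP => i j; rewrite !mxE entry.
Qed.

Lemma delta_row_mx n : delta_mx 0 0 = row_mx 1%:M 0 :> 'rV[R]_(1 + n).
Proof.
apply/rowP => j; rewrite -(splitK j); case: (split j) => k /=.
  by rewrite row_mxEl !mxE !ord1 !eqxx.
by rewrite row_mxEr !mxE.
Qed.

(** A unit eigenvector of [y^2] is moved to the first axis [e0]. Then [e0 y1 = c q] with [q] a unit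
    vector orthogonal to [e0], and [q y1] is a multiple of [e0]: the plane of [e0] and [q] is
    invariant, hence by skewness so is its complement. *)
Lemma skew_split n (y : 'M[R]_n.+2) : odd n.+1 -> y^T = - y ->
  exists G A y', [/\ orthogonal_mx G, y'^T = - y' &
    G *m y *m G^T = block_mx A 0 0 y' :> 'M_(2 + n)].
Proof.
move=> on yT; have [p [t [p1 pyy]]] := skew_sq_eigenvector yT.
have [H oH H0] := householder p1; have pH := unit_row_mul oH H0.
pose y1 := H *m y *m H^T : 'M_(1 + n.+1).
have y1T : y1^T = - y1 by exact: skew_conj.
pose e0 : 'rV[R]_(1 + n.+1) := delta_mx 0 0.
have e0yy : e0 *m y1 *m y1 = t *: e0.
  rewrite /e0 -pH /y1 !mulmxA.
  have hh := orthogonal_mx_tr oH.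
  rewrite -[p *m _ *m H]mulmxA hh mulmx1 -[_ *m H^T *m H]mulmxA hh mulmx1.
  by rewrite pyy -scalemxAl.
pose r := ursubmx y1; pose z := drsubmx y1.
have [ulT zT dlE] := skew_submx y1T.
have y1E : y1 = block_mx 0 r (- r^T) z.
  by rewrite -[LHS]submxK dlE (skew_mx11 ulT).
have e0E : e0 = row_mx 1%:M 0 by exact: delta_row_mx.
have [K [c [oK rK Kz]]] := exists_adapted_orthogonal_mx r on zT.
pose K1 : 'M[R]_(1 + n.+1) := block_mx 1%:M 0 0 K.
have oK1 : orthogonal_mx K1.
  by apply: orthogonal_block_mx => //; rewrite /orthogonal_mx trmx1 mulmx1.
pose q : 'rV[R]_(1 + n.+1) := row_mx 0 (row 0 K).
have e0K : row 0 K1 = e0.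
  have -> : row 0 K1 = e0 *m K1 by exact: rowE.
  rewrite e0E /K1 mul_row_block.
  by rewrite !mulmx0 !mul0mx mul1mx !addr0.
pose i1 : 'I_(1 + n.+1) := rshift 1 0.
have qK : row i1 K1 = q.
  apply/rowP => j; rewrite mxE -(splitK j); case: (split j) => k /=.
    by rewrite block_mxEdl row_mxEl !mxE.
  by rewrite block_mxEdr row_mxEr !mxE.
have e0y : e0 *m y1 = c *: q.
  rewrite e0E y1E mul_row_block mul1mx !mul0mx mul1mx !addr0.
  by rewrite /q scale_row_mx scaler0 -rK.
(* For [c != 0] this is [e0 y1 y1 = t e0] divided by [c]; for [c = 0] one has [r = 0], and [q] comes
   from the kernel of [z]. *)
have [t' qy] : exists t', q *m y1 = t' *: e0.
  have [c0|c0] := eqVneq c 0.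
    exists 0; rewrite scale0r y1E mul_row_block !mul0mx (Kz c0) rK c0.
    by rewrite scale0r raddf0 oppr0 mulmx0 !addr0 row_mx0.
  exists (c^-1 * t); apply: (scalerI c0); rewrite scalemxAl -e0y e0yy.
  by rewrite !scalerA mulrA mulfV // mul1r.
pose G := K1 *m H; pose y2 : 'M_(2 + n) := G *m y *m G^T.
have y2E : y2 = K1 *m y1 *m K1^T by rewrite /y2 /G trmx_mul !mulmxA.
have y2T : y2^T = - y2 by exact: skew_conj.
have row0y2 : row 0 y2 = c *: delta_mx 0 i1.
  by rewrite y2E !row_mul e0K e0y -scalemxAl -qK -row_mul oK1 row1.
have row1y2 : row i1 y2 = t' *: delta_mx 0 0.
  by rewrite y2E !row_mul qK qy -scalemxAl -e0K -row_mul oK1 row1.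
have ur0 : ursubmx y2 = 0.
  apply/matrixP => i j; rewrite !mxE.
  case: (@unliftP 2 0 i) => [i'|] ->.
    have -> : lshift n (lift 0 i') = i1 by rewrite ord1; apply: val_inj.
    by move/rowP/(_ (rshift 2 j)): row1y2; rewrite !mxE => ->; rewrite mulr0.
  have -> : lshift n (0 : 'I_2) = 0 by apply: val_inj.
  by move/rowP/(_ (rshift 2 j)): row0y2; rewrite !mxE => ->; rewrite mulr0.
have [_ drT dlE2] := skew_submx y2T.
exists G, (ulsubmx y2), (drsubmx y2); split.
- exact: orthogonal_mxM.
- exact: drT.
- by rewrite -/y2 -[LHS]submxK ur0 dlE2 ur0 raddf0 oppr0.
Qed.

(** For odd [n] the last index is alone in its class, which leaves a final 1 x 1 block. *)
Definition pair_diagonal n (y : 'M[R]_n) :=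
  forall i j : 'I_n, i./2 != j./2 -> y i j = 0.

Lemma skew_normal_form m (y : 'M[R]_m.*2) : y^T = - y ->
  exists2 G, orthogonal_mx G & pair_diagonal (G *m y *m G^T).
Proof.
elim: m y => [|m IHm] y yT.
  by exists 1%:M => [|[]]; rewrite // /orthogonal_mx trmx1 mulmx1.
have on : odd m.*2.+1 by rewrite /= odd_double.
have [G [A [y' [oG y'T yE]]]] := @skew_split m.*2 y on yT.
have [G' oG' nf] := IHm _ y'T.
pose H : 'M[R]_(2 + m.*2) := block_mx 1%:M 0 0 G'.
have oH : orthogonal_mx H.
  by apply: orthogonal_block_mx => //; rewrite /orthogonal_mx trmx1 mulmx1.
exists (H *m G); first exact: orthogonal_mxM.
have -> : H *m G *m y *m (H *m G)^T = block_mx A 0 0 (G' *m y' *m G'^T).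
  rewrite trmx_mul !mulmxA -(mulmxA H G) -(mulmxA H) yE tr_block_mx !trmx0 trmx1.
  by rewrite !mulmx_block !(mulmx0, mul0mx, mulmx1, mul1mx, addr0, add0r).
move=> i j; rewrite -(splitK (i : 'I_(2 + m.*2))) -(splitK (j : 'I_(2 + m.*2))).
case: (split (i : 'I_(2 + m.*2))) => i'; case: (split (j : 'I_(2 + m.*2))) => j' /= ij.
- by move: ij; case: i' => [[|[|?]] ?] //; case: j' => [[|[|?]] ?].
- by rewrite [LHS]block_mxEur mxE.
- by rewrite [LHS]block_mxEdl mxE.
- by rewrite [LHS]block_mxEdr nf.
Qed.
End RealSkew.

(** * Real coadjoint orbits *)

Section RealOrbits.
Variable R : rcfType.

Lemma orthogonal_det_sqr n (H : 'M[R]_n) : orthogonal_mx H -> \det H ^+ 2 = 1.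
Proof.
by move=> oH; have := congr1 determinant oH; rewrite det_mulmx det_tr det1 expr2.
Qed.

Lemma orthogonal_perm_mx n (s : 'S_n) : orthogonal_mx (perm_mx s : 'M[R]_n).
Proof. by rewrite /orthogonal_mx tr_perm_mx -perm_mxM mulgV perm_mx1. Qed.

Lemma perm_mx_conjE n (s : 'S_n) (M : 'M[R]_n) i j :
  (perm_mx s *m M *m (perm_mx s)^T) i j = M (s i) (s j).
Proof. by rewrite tr_perm_mx -col_permE -row_permE !mxE. Qed.

Lemma slice_intro l (x : so R l.*2.+1) (a : R) : pair_diagonal x ->
  exists b, (x, a *: delta_mx 0 ord_max) = slice b a.
Proof.
move=> nf; exists (\row_k x (inord k.*2) (inord k.*2.+1)).
congr (_, _); apply: val_inj; apply/matrixP => i j /=.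
have xT p q : x p q = - x q p.
  by have /matrixP/(_ q p) := eqP (so_skew x); rewrite !mxE.
have xd p : x p p = 0.
  by have /eqP := xT p p; rewrite -addr_eq0 -mulr2n mulrn_eq0 => /eqP.
rewrite slice_mxE std_symplecticE.
have [ij|ij] := eqVneq i./2 j./2; last first.
  rewrite nf //.
  have -> : ~~ odd i && (j == i.+1 :> nat) = false by lia.
  have -> : ~~ odd j && (i == j.+1 :> nat) = false by lia.
  by rewrite subrr mulr0.
(* The option is empty only at [i = 2l], and then [j = i]. *)
case: (insubP _ i./2) => [k ltk ek|geil] /=; last first.
  have -> : i = j by apply: val_inj => /=; have := ltn_ord i; have := ltn_ord j; lia.
  by rewrite xd mul0r.
have halves : i./2 = j./2 -> odd i = odd j -> i = j :> nat by lia.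
have [oij|oij] := eqVneq (odd i) (odd j).
  have -> : i = j by apply: val_inj; apply: halves.
  have -> : (j == j.+1 :> nat) = false by lia.
  by rewrite xd !andbF subrr mulr0.
have k2 : k.*2 = i./2.*2 by rewrite ek.
rewrite mxE k2; have [oi|oi] := boolP (odd i).
  have ij1 : i = j.+1 :> nat by move: ij oij oi; clear; lia.
  have oj : odd j = false by move: oij oi; clear; lia.
  rewrite oj ij1 eqxx sub0r mulrN1 xT /= uphalf_half oj add0n.
  by rewrite even_halfK ?oj // inord_val -ij1 inord_val.
have ji1 : j = i.+1 :> nat by move: ij oij oi; clear; lia.
have oj : odd j by move: oij oi; clear; lia.
by rewrite oj ji1 eqxx subr0 mulr1 even_halfK // inord_val -ji1 inord_val.
Qed.

Lemma drsubmxE m n (A : 'M[R]_(m + n)) i j :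
  drsubmx A i j = A (rshift m i) (rshift m j).
Proof. by rewrite !mxE. Qed.

(** [K] takes [w], or a kernel vector of [y] if [w = 0], to the first axis; [G] puts the
    complementary block in normal form; [P] moves the first axis to the last place. *)
Lemma exists_rotation l (lam : iso_dual R l.*2.+1) :
  exists (g : SO R l.*2.+1) (a : R),
    [/\ lam.2 *m g^T = a *: delta_mx 0 ord_max,
        forall i j : 'I_l.*2, i./2 != j./2 ->
          conj_so g lam.1 (lift ord_max i) (lift ord_max j) = 0
      & a = 0 -> forall j, conj_so g lam.1 ord_max j = 0].
Proof.
case: lam => y w; have yT := eqP (so_skew y).
have on : odd l.*2.+1 by rewrite /= odd_double.
have [K [c [oK wK Ky]]] := exists_adapted_orthogonal_mx w on yT.
pose y1 : 'M[R]_(1 + l.*2) := K *m y *m K^T.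
have [_ drT _] := skew_submx (skew_conj K yT : y1^T = - y1).
have [G oG nf] := skew_normal_form drT.
pose s : 'S_l.*2.+1 := lift_perm ord_max ord0 1.
pose P : 'M[R]_l.*2.+1 := perm_mx s.
(* The entry [e] of [D] on the first axis is the sign making [det g = e^2 = 1]. *)
pose e := \det P * \det G * \det K.
have e2 : e ^+ 2 = 1.
  rewrite !exprMn !orthogonal_det_sqr ?mulr1 //; exact: orthogonal_perm_mx.
pose D : 'M[R]_(1 + l.*2) := block_mx e%:M 0 0 G.
have oD : orthogonal_mx D.
  apply: orthogonal_block_mx => //.
  by rewrite /orthogonal_mx tr_scalar_mx -scalar_mxM -expr2 e2.
pose g := P *m D *m K.
have og : orthogonal_mx g.
  by do 2!apply: orthogonal_mxM => //; exact: orthogonal_perm_mx.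
have dg : \det g = 1.
  have dD : \det D = e * \det G by rewrite /D det_ublock det_scalar expr1.
  by rewrite /g !det_mulmx [X in _ * X * _]dD -e2 /e; ring.
have gP : (g^T *m g == 1%:M) && (\det g == 1).
  by rewrite (orthogonal_mx_tr og) dg !eqxx.
pose e0 : 'rV[R]_(1 + l.*2) := delta_mx 0 0.
have e0E : e0 = row_mx 1%:M 0 by exact: delta_row_mx.
have e0D : e0 *m D = e *: e0.
  rewrite e0E /D mul_row_block !mulmx0 !mul0mx mul1mx !addr0.
  by rewrite scale_row_mx scaler0 scalemx1.
have e0DT : e0 *m D^T = e *: e0.
  rewrite e0E /D tr_block_mx !trmx0 tr_scalar_mx mul_row_block.
  by rewrite !mulmx0 !mul0mx mul1mx !addr0 scale_row_mx scaler0 scalemx1.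
have xE i j : (g *m y *m g^T) i j = (D *m y1 *m D^T) (s i) (s j).
  have -> : g *m y *m g^T = P *m (D *m y1 *m D^T) *m P^T.
    by rewrite /g /y1 !trmx_mul !mulmxA.
  exact: perm_mx_conjE.
exists (MkSO gP), (c * e); split=> /=.
- have -> : w *m g^T = c *: (e0 *m D^T *m P^T).
    rewrite wK -scalemxAl /g !trmx_mul !mulmxA.
    by rewrite -row_mul oK row1.
  rewrite e0DT -scalemxAl scalerA; congr (_ *: _).
  rewrite /P tr_perm_mx -col_permE; apply/rowP => j; rewrite !mxE eqxx /=.
  congr (_ %:R); case: (unliftP ord_max j) => [k|] ->.
    by rewrite /s lift_perm_lift perm1 ![lift _ _ == _]eq_sym !(negPf (neq_lift _ _)).
  by rewrite /s lift_perm_id !eqxx.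
- have drM : drsubmx (D *m y1 *m D^T) = G *m drsubmx y1 *m G^T.
    rewrite -[in LHS](submxK y1) /D tr_block_mx !mulmx_block block_mxKdr.
    by rewrite !trmx0 !(mulmx0, mul0mx, addr0, add0r).
  move=> i j ij; rewrite xE /s !lift_perm_lift !perm1.
  have liftE (k : 'I_l.*2) : lift ord0 k = rshift 1 k by exact: val_inj.
  by rewrite !liftE -[LHS]drsubmxE drM nf.
(* Since [e] is a sign, [a = 0] forces [c = 0], the case in which the first row of [K] lies in the
   kernel of [y]. *)
- move=> /eqP; rewrite mulf_eq0 => /orP[/eqP c0|/eqP e0']; last first.
    by move/eqP: e2; rewrite e0' expr0n /= eq_sym oner_eq0.
  move=> j; rewrite xE /s lift_perm_id.
  have h : row ord0 (D *m y1 *m D^T) = 0.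
    rewrite !row_mul.
    have -> : row ord0 D = e0 *m D by exact: rowE.
    rewrite e0D -!scalemxAl /y1.
    have -> : e0 *m (K *m y *m K^T) = row ord0 K *m y *m K^T.
      by rewrite !mulmxA; congr (_ *m _ *m _); rewrite rowE.
    by rewrite (Ky c0) !mul0mx scaler0.
  move/rowP/(_ (s j)): h; rewrite mxE => ->.
  by rewrite mxE.
Qed.

Lemma real_orbit_meets_slice l (lam : iso_dual R l.*2.+1) :
  exists h b a, coAd h lam = slice b a.
Proof.
have [g [a [wg nf x0]]] := exists_rotation lam.
case: lam wg nf x0 => y w /= wg nf x0.
pose x : 'M[R]_l.*2.+1 := g *m y *m g^T.
have x_skew i j : x i j = - x j i.
  by have /matrixP/(_ j i) := eqP (conj_skew g y); rewrite !mxE.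
(* Translation by [u] adds [a u_i] to entry [i] of the last column, so this [u] clears it. If
   [a = 0], division by zero gives [u = 0], and the column already vanishes by [x0]. *)
pose u : 'cV[R]_l.*2.+1 := \col_i (- x i ord_max / a).
pose x' := So (add_skew (conj_so g y) (u *m (a *: delta_mx 0 ord_max))).
have [|b sb] := @slice_intro l x' a; last first.
  by exists (g, u), b, a; rewrite /= -sb; congr (_, _) => //;
    apply: val_inj; rewrite /= wg.
have x'E i j : x' i j = x i j + (u i 0 * (a * (j == ord_max)%:R)
                                 - u j 0 * (a * (i == ord_max)%:R)).
  rewrite /= [LHS]mxE -/x; congr (_ + _).
  by rewrite [LHS]mxE [X in _ + X]mxE [X in _ - X]mxE !mxE !big_ord1 !mxE !eqxx.
have uE k : u k 0 = - x k ord_max / a by rewrite mxE.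
have xmax i : i != ord_max -> x' i ord_max = 0.
  move=> im; rewrite x'E eqxx (negPf im) !mulr0 subr0 mulr1 uE.
  have [a0|a0] := eqVneq a 0; last by rewrite divfK // subrr.
  by rewrite a0 mulr0 addr0 x_skew (x0 a0) oppr0.
have x'_skew i j : x' i j = - x' j i.
  by have /matrixP/(_ j i) := eqP (so_skew x'); rewrite !mxE.
move=> i j; case: (unliftP ord_max i) => [i'|] ->; last first.
  case: (unliftP ord_max j) => [j'|] -> ij; last by rewrite eqxx in ij.
  by rewrite x'_skew xmax ?oppr0 // eq_sym neq_lift.
case: (unliftP ord_max j) => [j'|] -> ij.
  (* Off the last row and column the translation changes nothing, so the normal form persists. *)
  rewrite x'E ![lift _ _ == _]eq_sym !(negPf (neq_lift _ _)) !mulr0 subrr addr0.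
  by apply: nf; move: ij; rewrite !lift_max.
by rewrite xmax // eq_sym neq_lift.
Qed.
End RealOrbits.

(** * From real to complex points *)

Section BaseChange.
Variables (F G : numFieldType) (f : {rmorphism F -> G}).

Fact map_so_skew n (x : so F n) : map_mx f x \in @Defs.skew G n.
Proof. by rewrite skewE map_trmx (eqP (so_skew x)) map_mxN. Qed.
Definition map_so n (x : so F n) : so G n := So (map_so_skew x).

Fact map_SO_prop n (g : SO F n) :
  ((map_mx f g)^T *m map_mx f g == 1%:M) && (\det (map_mx f g) == 1).
Proof.
by rewrite map_trmx -map_mxM SO_trmxM map_mx1 det_map_mx SO_det rmorph1 !eqxx.
Qed.
Definition map_SO n (g : SO F n) : SO G n := MkSO (map_SO_prop g).

Definition map_dual n (lam : iso_dual F n) : iso_dual G n :=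
  (map_so lam.1, map_mx f lam.2).

(** The coadjoint action is polynomial in the matrix entries, so it commutes with base change. *)
Lemma map_dual_coAd n (h : ISO F n) (lam : iso_dual F n) :
  map_dual (coAd h lam) = coAd (map_SO h.1, map_mx f h.2) (map_dual lam).
Proof.
case: h lam => g u [y w]; congr (_, _) => /=; last by rewrite map_mxM -map_trmx.
apply: val_inj; rewrite /= map_mxD map_mxB -!map_trmx !map_mxM.
by rewrite -!map_trmx.
Qed.

Lemma map_dual_slice l (b : 'rV[F]_l) a :
  map_dual (slice b a) = slice (map_mx f b) (f a).
Proof.
congr (_, _); last by rewrite /= map_mxZ map_delta_mx.
apply: val_inj; rewrite /= /slice_mx raddf_sum; apply: eq_bigr => k _.
by rewrite /= map_mxZ map_mxB !map_delta_mx mxE.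
Qed.

Lemma map_dual_line n (lam mu : iso_dual F n) t :
  map_dual (lam + t *: mu) = map_dual lam + f t *: map_dual mu.
Proof.
by congr (_, _); [apply: val_inj|]; rewrite /= map_mxD map_mxZ.
Qed.
End BaseChange.

Lemma polynomial_function_line (F : numFieldType) (V : lmodType F) (f : V -> F)
    (u v : V) :
  polynomial_function f -> exists q : {poly F}, forall t, f (u + t *: v) = q.[t].
Proof.
case=> k [p [L fE]].
exists (\sum_(m <- msupp p) p@_m *: \prod_i ((L i u)%:P + L i v *: 'X) ^+ m i).
move=> t; rewrite fE mevalE horner_sum; apply: eq_bigr => m _.
rewrite hornerZ horner_prod; congr (_ * _); apply: eq_bigr => i _.
by rewrite horner_exp hornerD hornerC hornerZ hornerX linearD linearZ /= mulrC.
Qed.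

(** The naturals are distinct in characteristic 0, so [p - q] has as many distinct roots as its
    size. *)
Lemma poly_eq_nat (F : numFieldType) (p q : {poly F}) :
  (forall n : nat, p.[n%:R] = q.[n%:R]) -> p = q.
Proof.
move=> epq; apply/eqP; rewrite -subr_eq0; apply/eqP.
pose rs : seq F := [seq n%:R | n <- iota 0 (size (p - q))].
apply: (@roots_geq_poly_eq0 _ _ rs).
- by apply/allP => _ /mapP[n _ ->]; rewrite rootE hornerD hornerN epq subrr.
- by rewrite map_inj_uniq ?iota_uniq //; exact: (mulrIn (oner_neq0 _)).
- by rewrite size_map size_iota.
Qed.

(** * Uniqueness of an invariant with given values on the slice *)

Section ComplexDual.
Variable R : realType.
Notation real_dual := (map_dual (real_complex R : {rmorphism R -> R[i]})).

Lemma complex_dual_decomposition n (lam : iso_dual R[i] n) :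
  exists A B, lam = real_dual A + 'i%C *: real_dual B.
Proof.
case: lam => y w.
have yT i j : y j i = - y i j.
  by have /matrixP/(_ i j) := eqP (so_skew y); rewrite !mxE.
have skRe : map_mx (@complex.Re R) y \in @Defs.skew R n.
  by rewrite skewE; apply/eqP/matrixP => i j; rewrite !mxE yT; case: (so_val y i j).
have skIm : map_mx (@complex.Im R) y \in @Defs.skew R n.
  by rewrite skewE; apply/eqP/matrixP => i j; rewrite !mxE yT; case: (so_val y i j).
exists (So skRe, map_mx (@complex.Re R) w), (So skIm, map_mx (@complex.Im R) w).
congr (_, _); last by apply/matrixP => i j; rewrite !mxE -complexE.
by apply: val_inj; apply/matrixP => i j; rewrite !mxE -complexE.
Qed.

Lemma in_Yc_eq_on_slice l (f g : iso_dual R[i] l.*2.+1 -> R[i]) :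
  in_Yc f -> in_Yc g ->
  (forall b a, f (slice b a) = g (slice b a)) -> f =1 g.
Proof.
move=> [pf invf] [pg invg] fg lam.
have fg_real mu : f (real_dual mu) = g (real_dual mu).
  have [h [b [a hb]]] := real_orbit_meets_slice mu.
  pose hC : ISO R[i] _ := (map_SO (real_complex R) h.1, map_mx (real_complex R) h.2).
  rewrite -(invf hC) -(invg hC).
  by rewrite -map_dual_coAd hb map_dual_slice.
have [A [B ->]] := complex_dual_decomposition lam.
have [p fp] := polynomial_function_line (real_dual A) (real_dual B) pf.
have [q gq] := polynomial_function_line (real_dual A) (real_dual B) pg.
(* The given point is at parameter ['i]; at natural parameters the line passes through real points,
   where [fg_real] applies. *)
rewrite fp gq (@poly_eq_nat _ p q) // => n.
by rewrite -fp -gq -(rmorph_nat (real_complex R)) -map_dual_line.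
Qed.
End ComplexDual.

Theorem mainTheorem4 (R : realType) (l : nat) :
  exists Phi : iso_dual R[i] l.*2.+1 -> R[i],
    [/\ in_Yc Phi,
        forall (b : 'rV[R[i]]_l) (a : R[i]), Phi (slice b a) = slice_phi b a,
        forall Psi : iso_dual R[i] l.*2.+1 -> R[i],
          in_Yc Psi ->
          (forall (b : 'rV[R[i]]_l) (a : R[i]),
              Psi (slice b a) = slice_phi b a) ->
          Psi =1 Phi
      & exists s : bool,
          forall lam : iso_dual R[i] l.*2.+1,
            Phi lam = (-1) ^+ s * Pf (bordered lam)].
Proof.
(* The sign -1 compensates the one in [Pf_bordered_slice]. *)
pose Phi (lam : iso_dual R[i] l.*2.+1) := (-1) ^+ true * Pf (bordered lam).
have PhiY : in_Yc Phi.
  split; first exact: polynomial_function_Pf_bordered.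
  by move=> h lam; rewrite /Phi Pf_bordered_coAd //= odd_double.
have Phi_slice b a : Phi (slice b a) = slice_phi b a.
  by rewrite /Phi Pf_bordered_slice expr1 mulN1r opprK.
exists Phi; split=> //; last by exists true.
move=> Psi PsiY Psi_slice; apply: in_Yc_eq_on_slice => // b a.
by rewrite Psi_slice Phi_slice.
Qed.
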